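(* Let $C$ be an $[n,k,d]_qR$ code that is uniformly packed in the wide sense. Then all cosets of $C$ of weight $R$ have the same weight distribution, and $C$ is an $(R,\mathcal{A}_R)$-APMCF code, where $\mathcal{A}_R$ is the number of vectors of Hamming weight $R$ in any coset of $C$ of weight $R$. If moreover $d\ge2R$, then $C$ is an $(R,\mathcal{A}_R)$-PMCF code.
   Context: An $[n,k,d]_qR$ code is a $k$-dimensional linear subspace $C$ of $\mathbb{F}_q^n$ with minimum distance $d$ and covering radius $R$. A coset of $C$ is $C+u$, $u\in\mathbb{F}_q^n$; its weight is the minimum Hamming weight of its vectors, and its weight distribution is the list of numbers of its vectors of each weight. $B_j(v,C)$ is the number of codewords at Hamming distance $j$ from $v$. $C$ is uniformly packed in the wide sense (UPWS) if there exist rationals $\beta_0,\dots,\beta_R$ with $\sum_{j=0}^R\beta_jB_j(v,C)=1$ for all $v\in\mathbb{F}_q^n$. $C$ is an $(R,\lambda)$-APMCF code if $B_R(v,C)=\lambda$ for all $v$ with $d(v,C)=R$; it is $(R,\lambda)$-PMCF if in addition $d\ge2R$. *)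

(* Defs.v *)
From HB Require Import structures.
From mathcomp Require Import all_boot all_order all_algebra.

Set Implicit Arguments.
Unset Strict Implicit.
Unset Printing Implicit Defensive.

Import GRing.Theory.
Local Open Scope ring_scope.

Section Codes.

Variables (F : finFieldType) (n : nat).
Implicit Types (C : {vspace 'rV[F]_n}) (v u x y : 'rV[F]_n).
Implicit Types (S : {set 'rV[F]_n}).

Definition hweight x : nat := #|[set i | x 0 i != 0]|.

Definition hdist x y : nat := #|[set i | x 0 i != y 0 i]|.

(* The default value n of the minimum is harmless: distances and weights are
   at most n, and codes and cosets are nonempty. *)
Definition dist_code v C : nat := \big[minn/n]_(c in C) hdist v c.

Definition covering_radius C : nat := \max_(v : 'rV[F]_n) dist_code v C.

(* A relation rather than a function: the zero code has no minimum distance. *)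
Definition is_min_dist C (d : nat) : Prop :=
  (exists x y, [/\ x \in C, y \in C, x != y & hdist x y = d]) /\
  (forall x y, x \in C -> y \in C -> x != y -> (d <= hdist x y)%N).

(* C is an [n,k,d]_q R code. *)
Definition is_code (q k d R : nat) C : Prop :=
  [/\ #|F| = q, \dim C = k, is_min_dist C d & covering_radius C = R].

Definition code_coset C u : {set 'rV[F]_n} := [set c + u | c in C].

Definition is_coset C S : Prop := exists u, S = code_coset C u.

Definition coset_weight S : nat := \big[minn/n]_(x in S) hweight x.

Definition num_weight S (w : nat) : nat := #|[set x in S | hweight x == w]|.

Definition weight_distribution S : {ffun 'I_n.+1 -> nat} :=
  [ffun w : 'I_n.+1 => num_weight S w].

(* B_j(v, C) *)
Definition num_dist (j : nat) v C : nat := #|[set c in C | hdist v c == j]|.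

Definition upws C : Prop :=
  exists beta : 'I_(covering_radius C).+1 -> rat,
    forall v, \sum_(j < (covering_radius C).+1) beta j * (num_dist j v C)%:R = 1.

Definition apmcf (R lambda : nat) C : Prop :=
  covering_radius C = R /\
  forall v, dist_code v C = R -> num_dist R v C = lambda.

Definition pmcf (R lambda : nat) C : Prop :=
  apmcf R lambda C /\ exists2 d, is_min_dist C d & (2 * R <= d)%N.

End Codes.

(* Main.v *)
(** Write L_g(v) for the sum of g(d(v,c)) over the codewords c. Summing L_g
    over all ways of overwriting one coordinate of v gives L_(Tg)(v), where T
    is a tridiagonal operator on functions of the distance that enlarges the
    support by exactly one step. The packing identity says that L_beta is
    constant, with beta supported on [0, R]; hence all the L_(T^m beta) are
    constant, and they form a triangular system which determines B_(R+m)(v)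
    from the B_j(v) with j < R+m. At a vector v of distance R the numbers
    B_j(v), j < R, vanish, so all the B_j(v) are determined; beta_R is nonzero
    because beta_R B_R(v) = 1. *)
Require Import Defs.
From HB Require Import structures.
From mathcomp Require Import all_boot all_order all_algebra.

Set Implicit Arguments.
Unset Strict Implicit.
Unset Printing Implicit Defensive.

Import GRing.Theory.
Local Open Scope ring_scope.

(** Only the upper bound by a member matters later, so the default value [n] never enters. *)
Lemma bigminn_le (I : finType) (P : pred I) (f : I -> nat)
    (n : nat) (j : I) :
  P j -> (\big[minn/n]_(i | P i) f i <= f j)%N.
Proof.
rewrite -big_filter => Pj.
have : j \in [seq i <- index_enum I | P i] by rewrite mem_filter Pj mem_index_enum.
elim: [seq _ <- _ | _] => //= x s IHs.
rewrite inE big_cons => /predU1P[<-|/IHs le_s]; first exact: geq_minl.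
exact: leq_trans (geq_minr _ _) le_s.
Qed.

Section DistanceSums.

Variables (F : finFieldType) (n : nat) (C : {vspace 'rV[F]_n}).
Implicit Types (v w c : 'rV[F]_n) (g : nat -> rat).

Definition set_coord v (i : 'I_n) (a : F) : 'rV[F]_n :=
  \row_j (if j == i then a else v 0 j).

Lemma hdist_coord v c i :
  hdist v c = ((v 0%R i != c 0%R i) + #|[set j | v 0%R j != c 0%R j] :\ i|)%N.
Proof. by rewrite /hdist (cardsD1 i) inE. Qed.

Lemma hdist_set_coord v c i a :
  hdist (set_coord v i a) c =
  ((a != c 0%R i) + #|[set j | v 0%R j != c 0%R j] :\ i|)%N.
Proof.
rewrite (hdist_coord _ _ i) mxE eqxx; congr (_ + #|pred_of_set _|)%N.
by apply/setP=> j; rewrite !inE mxE; case: eqP.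
Qed.

(** The operator T, with k the distance from v to a codeword. At each of the k disagreeing
    coordinates one value lowers the distance and the other q-1 keep it; at each agreeing one, one
    value keeps it and q-1 raise it. At k = 0 the term in [k.-1] is multiplied by zero. *)
Definition coord_sum g (k : nat) : rat :=
  (g k.-1 + g k *+ #|F|.-1) *+ k + (g k + g k.+1 *+ #|F|.-1) *+ (n - k).

Lemma sum_set_coord g v c :
  \sum_i \sum_a g (hdist (set_coord v i a) c) = coord_sum g (hdist v c).
Proof.
have inner i : \sum_a g (hdist (set_coord v i a) c) =
    let r := #|[set j | v 0 j != c 0 j] :\ i| in g r + g r.+1 *+ #|F|.-1.
  rewrite (bigD1 (c 0 i)) //= hdist_set_coord eqxx add0n; congr (_ + _).
  rewrite -(cardC1 (c 0 i)) -sumr_const; apply: eq_bigr => a /= a_c.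
  by rewrite hdist_set_coord a_c.
under eq_bigr => i _ do rewrite inner /=.
(* The number of disagreements outside i is one less than the distance if v and c differ at i, and
   equals it otherwise. *)
rewrite (bigID (fun i => v 0 i != c 0 i)) /=; congr (_ + _).
  rewrite {3}/hdist -sum1_card -sumrMnr.
  under [RHS]eq_bigl => i do rewrite inE.
  apply: eq_bigr => i vi; rewrite mulr1n.
  by rewrite (hdist_coord v c i) vi add1n.
have -> : (n - hdist v c)%N = #|[pred i | ~~ (v 0 i != c 0 i)]|.
  rewrite -cardsE cardsCs card_ord /hdist; congr (n - _)%N.
  by apply: eq_card => i; rewrite !inE negbK.
rewrite -sumr_const; apply: eq_bigr => i /negbTE vi.
by rewrite (hdist_coord v c i) vi add0n.
Qed.

Definition dist_sum g v : rat := \sum_(c in C) g (hdist v c).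

Lemma dist_sumT g v :
  \sum_i \sum_a dist_sum g (set_coord v i a) = dist_sum (coord_sum g) v.
Proof.
under eq_bigr do rewrite exchange_big /=.
by rewrite exchange_big /=; apply: eq_bigr => c _; exact: sum_set_coord.
Qed.

Lemma dist_sum_num_dist g v N :
  (forall k, (N < k)%N -> g k = 0) ->
  dist_sum g v = \sum_(j < N.+1) g j * (num_dist j v C)%:R.
Proof.
move=> g0; under eq_bigr => j _.
  rewrite /num_dist -sum1_card natr_sum mulr_sumr.
  under eq_bigl => c do rewrite inE.
  rewrite big_mkcondr /=; over.
rewrite exchange_big /=; apply: eq_bigr => c _.
(* A codeword within distance N is counted at exactly one index j; a farther one contributes 0 to
   both sides. *)
have [le_dN|lt_Nd] := leqP (hdist v c) N.
  rewrite (bigD1 (inord (hdist v c))) //= inordK // eqxx mulr1.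
  rewrite big1 ?addr0 // => j j_d; case: eqP => // dj.
  by rewrite dj inord_val eqxx in j_d.
rewrite g0 // big1 // => j _; case: eqP => // dj.
by have := ltn_ord j; rewrite -dj ltnS leqNgt lt_Nd.
Qed.

Lemma num_dist_lt v R j :
  (forall c, c \in C -> (R <= hdist v c)%N) -> (j < R)%N -> num_dist j v C = 0%N.
Proof.
move=> far lt_jR; apply/eqP; rewrite cards_eq0; apply/eqP/setP=> c.
rewrite !inE; apply/negP=> /andP[/far le_R /eqP dj].
by rewrite dj leqNgt lt_jR in le_R.
Qed.

Lemma iter_coord_sum_support g R m :
  (forall k, (R < k)%N -> g k = 0) ->
  forall k, (R + m < k)%N -> iter m coord_sum g k = 0.
Proof.
move=> g0; elim: m => [|m IHm] k; first by rewrite addn0; exact: g0.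
rewrite addnS; case: k => // k lt_k /=; rewrite /coord_sum /=.
by rewrite !IHm ?mul0rn ?addr0 ?mul0rn // !leqW.
Qed.

(** At the new top index k only the [k.-1] term survives, so each application of T multiplies the
    leading value by k > 0, nonzero in the rationals. *)
Lemma iter_coord_sum_lead g R m :
  (forall k, (R < k)%N -> g k = 0) -> g R != 0 ->
  iter m coord_sum g (R + m)%N != 0.
Proof.
move=> g0 gR; elim: m => [|m IHm]; first by rewrite addn0.
have g0m := iter_coord_sum_support (m := m) g0.
rewrite addnS /= /coord_sum /= (g0m (R + m).+1) // (g0m (R + m).+2) //.
by rewrite !(mul0rn, addr0) Num.Theory.mulrn_eq0.
Qed.

Lemma iter_dist_sum_const g m v w :
  (forall v w, dist_sum g v = dist_sum g w) ->
  dist_sum (iter m coord_sum g) v = dist_sum (iter m coord_sum g) w.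
Proof.
move=> gC; elim: m v w => [|m IHm] v w //=.
by rewrite -!dist_sumT; do 2!apply: eq_bigr => ? _.
Qed.

Lemma upws_num_dist v w j :
  upws C -> (forall c, c \in C -> (covering_radius C <= hdist v c)%N) ->
  (forall c, c \in C -> (covering_radius C <= hdist w c)%N) ->
  num_dist j v C = num_dist j w C.
Proof.
set R := covering_radius C; case=> beta packed far_v far_w.
(* Extending beta by zero past R lets T be iterated without a bound on the index. *)
pose g k := if (k <= R)%N then beta (inord k) else 0.
have g0 k : (R < k)%N -> g k = 0 by rewrite /g ltnNge => /negbTE->.
have g1 x : dist_sum g x = 1.
  rewrite (dist_sum_num_dist _ g0) -[RHS](packed x); apply: eq_bigr => i _.
  by rewrite /g -ltnS ltn_ord inord_val.
have gR : g R != 0.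
  apply/eqP=> gR0; have := g1 v; rewrite (dist_sum_num_dist _ g0).
  rewrite big_ord_recr /= gR0 mul0r addr0 big1 => [/esym/eqP|i _].
    by rewrite oner_eq0.
  by rewrite (num_dist_lt far_v) // mulr0.
elim/ltn_ind: j => j IHj.
have [lt_jR|le_Rj] := ltnP j R.
  by rewrite (num_dist_lt far_v) // (num_dist_lt far_w).
(* With j - R iterations the support ends exactly at j: the terms below j agree by induction, and
   the nonzero leading coefficient cancels. *)
have := iter_dist_sum_const (j - R) v w (fun x y => etrans (g1 x) (esym (g1 y))).
have lead := iter_coord_sum_lead (j - R) g0 gR.
have := iter_coord_sum_support (m := j - R) g0.
move: lead; rewrite subnKC // => lead supp.
rewrite !(dist_sum_num_dist _ supp) !big_ord_recr /=.
under eq_bigr => i _ do rewrite IHj //.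
move/addrI/(mulfI lead)/eqP; rewrite Num.Theory.eqr_nat => /eqP; exact.
Qed.

(** Turns weights in the coset C + u into distances from -u, so that results on [num_dist] apply to
    cosets. *)
Lemma hweight_add c u : hweight (c + u) = hdist (- u) c.
Proof.
rewrite /hweight /hdist; apply: eq_card => i.
by rewrite !inE !mxE addr_eq0 eq_sym.
Qed.

Lemma num_weight_coset u j : num_weight (code_coset C u) j = num_dist j (- u) C.
Proof.
rewrite /num_weight /num_dist -[RHS](card_imset _ (addIr u)).
apply: eq_card => x; rewrite !inE; apply/andP/imsetP.
  case=> /imsetP[c Cc ->]; rewrite hweight_add => dj.
  by exists c; rewrite // inE Cc.
case=> c; rewrite inE => /andP[Cc dj] ->; rewrite hweight_add; split=> //.
by apply/imsetP; exists c.
Qed.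

Lemma coset_weight_le u c :
  c \in C -> (coset_weight (code_coset C u) <= hdist (- u) c)%N.
Proof.
by move=> Cc; rewrite -hweight_add; apply: bigminn_le; apply: imset_f.
Qed.

Lemma dist_code_le v c : c \in C -> (dist_code v C <= hdist v c)%N.
Proof. by move=> Cc; apply: bigminn_le. Qed.

Lemma covering_radius_attained : exists v, dist_code v C = covering_radius C.
Proof.
have [|v dv] := @eq_bigmax _ (fun v => dist_code v C); last by exists v.
by apply/card_gt0P; exists 0.
Qed.

End DistanceSums.

Theorem theorem5p2 (F : finFieldType) (q n k d R : nat)
    (C : {vspace 'rV[F]_n}) (hC : is_code q k d R C) (hU : upws C) :
  (forall S T : {set 'rV[F]_n},
      is_coset C S -> is_coset C T ->
      coset_weight S = R -> coset_weight T = R ->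
      weight_distribution S = weight_distribution T) /\
  (exists A_R : nat,
      [/\ forall S : {set 'rV[F]_n},
            is_coset C S -> coset_weight S = R -> num_weight S R = A_R,
          apmcf R A_R C
        & (2 * R <= d)%N -> pmcf R A_R C]).
Proof.
case: hC => _ _ min_d; move: R => _ <-.
have far_coset u : coset_weight (code_coset C u) = covering_radius C ->
    forall c, c \in C -> (covering_radius C <= hdist (- u) c)%N.
  by move=> <-; exact: coset_weight_le.
have far_dist v : dist_code v C = covering_radius C ->
    forall c, c \in C -> (covering_radius C <= hdist v c)%N.
  by move=> <-; exact: dist_code_le.
split=> [_ _ [u ->] [v ->] /far_coset far_u /far_coset far_v|].
  by apply/ffunP=> j; rewrite !ffunE !num_weight_coset; exact: upws_num_dist.
have [v0 /far_dist far_v0] := covering_radius_attained C.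
(* Any vector at maximal distance from C could serve here, since all of them give the same count. *)
exists (num_dist (covering_radius C) v0 C).
have apmcfC : apmcf (covering_radius C) (num_dist (covering_radius C) v0 C) C.
  by split=> // v /far_dist far_v; exact: upws_num_dist.
split=> // [_ [u ->] /far_coset far_u|le_d]; last by split=> //; exists d.
by rewrite num_weight_coset; exact: upws_num_dist.
Qed.
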